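(* There is a sequence of real numbers $(\varepsilon_n)$ with $\varepsilon_n\to 0$ as $n\to\infty$ such that for all odd integers $n\ge 3$ and all integers $\xi$ with $\frac{n}{\log n}\le\xi<\frac n2$, the smallest eigenvalue $\beta_*(\xi)$ of $M(\xi)$ satisfies $$\beta_*(\xi)\ge -1+\frac34\left(\frac{\xi}{n}\right)^2(1+\varepsilon_n).$$
   Context: For integers $n\ge 3$ and $\xi$, $M(\xi)$ is the real symmetric $n\times n$ matrix with rows and columns indexed by $0,1,\dots,n-1$, with diagonal entries $\frac12\cos\left(\frac{2\pi\xi j}{n}\right)$ for $0\le j\le n-1$, entries $\frac14$ on the superdiagonal and the subdiagonal and in the upper right and lower left corners, and all other entries $0$. Here $\log$ is the natural logarithm. *)

(* Defs.v *)
From HB Require Import structures.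
From mathcomp Require Import all_boot all_order all_algebra.
From mathcomp Require Import all_classical all_reals all_analysis.
From mathcomp Require complex.

Set Implicit Arguments.
Unset Strict Implicit.
Unset Printing Implicit Defensive.

Import Order.TTheory GRing.Theory Num.Theory.
Import numFieldNormedType.Exports.

Local Open Scope classical_set_scope.
Local Open Scope ring_scope.

Definition cyclic_neighbours (n : nat) (i j : 'I_n) : bool :=
  [|| i.+1 == j, j.+1 == i,
      (i == 0 :> nat) && (j == n.-1 :> nat) |
      (i == n.-1 :> nat) && (j == 0 :> nat)].

(* Intended for n >= 3: for smaller n the positions of the off-diagonal
   entries are not pairwise distinct. *)
Definition Mxi (R : realType) (n : nat) (xi : int) : 'M[R]_n :=
  \matrix_(i, j)
    if i == j then 1 / 2 * cos (2 * pi * xi%:~R * j%:R / n%:R)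
    else if cyclic_neighbours i j then 1 / 4
    else 0.

Definition is_smallest_eigenvalue (R : realType) (n : nat)
    (A : 'M[R]_n) (b : R) : Prop :=
  eigenvalue A b /\ forall a : R, eigenvalue A a -> b <= a.

Lemma Mxi_sym (R : realType) (n : nat) (xi : int) :
  (Mxi R n xi)^T = Mxi R n xi.
Proof.
apply/matrixP => i j; rewrite !mxE.
have -> : cyclic_neighbours j i = cyclic_neighbours i j.
  rewrite /cyclic_neighbours orbCA; congr [|| _, _ | _].
  by rewrite orbC andbC [X in _ || X]andbC.
by rewrite eq_sym; case: eqP => // ->.
Qed.

Section SymmetricEigenvalue.
Import complex.

Lemma symmetric_has_eigenvalue (R : realType) (n : nat) (A : 'M[R]_n) :
  (0 < n)%N -> A^T = A -> exists a : R, eigenvalue A a.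
Proof.
move=> n_gt0 symA.
pose f : {rmorphism R -> R[i]%C} := real_complex R.
pose B := map_mx f A.
have [c Bc] : exists c, eigenvalue B c by exact: spectral.eigenvalue_closed.
have /eigenvalueP[v vB v0] := Bc.
pose w := (map_mx Num.conj v)^T.
have conjB : map_mx Num.conj B = B.
  apply/matrixP => i j; rewrite !mxE; apply: CrealP.
  by apply/complex_realP; exists (A i j).
have symB : B^T = B by rewrite /B map_trmx symA.
pose s := (v *m w) 0 0.
have sE : s = \sum_k `|v 0 k| ^+ 2.
  by rewrite /s mxE; apply: eq_bigr => k _; rewrite !mxE normCK.
have s_neq0 : s != 0.
  apply: contra v0; rewrite sE psumr_eq0; last by move=> k _; rewrite exprn_ge0.
  move=> /allP h; apply/eqP/rowP => k; rewrite !mxE; apply/eqP.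
  by have := h k (mem_index_enum k); rewrite /= sqrf_eq0 normr_eq0.
have s_real : Num.conj s = s.
  by apply: CrealP; rewrite sE; apply: rpred_sum => k _; rewrite rpredX ?normr_real.
have wB : B *m w = Num.conj c *: w.
  have := congr1 (fun u => (map_mx Num.conj u)^T) vB.
  by rewrite map_mxM conjB trmx_mul symB map_mxZ linearZ.
have c_real : Num.conj c = c.
  have h : c *: (v *m w) = Num.conj c *: (v *m w).
    by rewrite scalemxAl -vB -mulmxA wB scalemxAr.
  move: h => /matrixP /(_ 0 0); rewrite mxE [RHS]mxE -/s.
  by move/(mulIf s_neq0).
have /complex_realP[a ca] : c \is Num.real by apply/CrealP.
by exists a; rewrite -(eigenvalue_map f) -/B /= -ca.
Qed.

End SymmetricEigenvalue.

Lemma smallest_eigenvalue_exists (R : realType) (n : nat) (A : 'M[R]_n) :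
  (0 < n)%N -> A^T = A -> exists b : R, is_smallest_eigenvalue A b.
Proof.
move=> n_gt0 symA; have [a Aa] := symmetric_has_eigenvalue n_gt0 symA.
have pn0 : char_poly A != 0 by rewrite monic_neq0 ?char_poly_monic.
have bnd (m : nat) : forall a, eigenvalue A a ->
    (forall s : seq R, uniq s -> all (eigenvalue A) s ->
       all (< a) s -> (size s <= m)%N) ->
    exists b, is_smallest_eigenvalue A b.
  elim: m => [|m IH] x Ax hx.
    exists x; split=> // y Ay; rewrite leNgt; apply/negP => yx.
    by have := hx [:: y]; rewrite /= Ay yx => /(_ isT isT isT).
  case: (pselect (exists2 y, eigenvalue A y & y < x)) => [[y Ay yx]|nex].
    apply: (IH y Ay) => s us As sy.
    rewrite -ltnS; apply: (hx (y :: s)); rewrite /= ?us ?Ay ?As ?yx ?andbT //.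
      by apply/negP => /(allP sy) /=; rewrite ltxx.
    by apply/allP => z /(allP sy) /= /lt_trans; exact.
  exists x; split=> // y Ay; rewrite leNgt; apply/negP => yx.
  by apply: nex; exists y.
apply: (bnd (size (char_poly A)) a Aa) => s us As _.
apply/ltnW/max_poly_roots => //.
by apply/allP => z /(allP As); rewrite eigenvalue_root_char.
Qed.

Lemma Mxi_smallest_eigenvalue_exists (R : realType) (n : nat) (xi : int) :
  (3 <= n)%N -> exists b : R, is_smallest_eigenvalue (Mxi R n xi) b.
Proof.
move=> n_ge3; apply: smallest_eigenvalue_exists; last exact: Mxi_sym.
exact: leq_trans n_ge3.
Qed.

(* Main.v *)
(* Positive trial vector.  If the off-diagonal part of a column [j] of [A],
   taken in absolute value, satisfies
   [\sum_(i != j) |A i j| u i <= (A j j - e) u j] for some [u > 0], then reading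
   the eigenvector equation at an index maximising [|v j| / u j] gives [b >= e]
   for every eigenvalue [b].  For [M(xi)], with [phi = 2 pi xi / n], the choice
   [u j = 1 - cos (phi j) / 3] (largest at the wells of the diagonal potential)
   works with [e = -1 + (1 - cos phi) / 8].  Since
   [1 - cos phi = 2 sin^2 (pi xi / n) >= 8 (xi / n)^2] by Jordan's inequality,
   every eigenvalue is at least [-1 + (xi / n)^2], so that [eps n = 0] works. *)
Require Import Defs.
From mathcomp Require Import all_boot all_order all_algebra.
From mathcomp Require Import all_classical all_reals all_analysis.
From mathcomp Require Import ring lra zify.
Import Order.TTheory GRing.Theory Num.Theory.
Import numFieldNormedType.Exports.
Local Open Scope classical_set_scope.
Local Open Scope ring_scope.

Lemma eigenvalue_ge_of_positive_vector (R : realFieldType) (n : nat)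
    (A : 'M[R]_n) (u : 'I_n -> R) (e b : R) :
  (forall i, 0 < u i) ->
  (forall j, \sum_(i | i != j) `|A i j| * u i <= (A j j - e) * u j) ->
  eigenvalue A b -> e <= b.
Proof.
move=> u_gt0 Au /eigenvalueP[v vA v_neq0].
have [k vk_neq0] : exists k, v 0 k != 0.
  by apply/existsP; apply: contraNT v_neq0 => /existsPn v0;
    apply/eqP/rowP => k; rewrite mxE; apply/eqP/negPn/v0.
case: (@arg_maxP _ _ _ k xpredT (fun j => `|v 0 j| / u j)) => // j _ jmax.
set t := `|v 0 j| / u j in jmax.
have t_gt0 : 0 < t.
  by apply: lt_le_trans (jmax k isT); rewrite divr_gt0 ?normr_gt0.
have vj : `|v 0 j| = t * u j by rewrite divfK // gt_eqF.
have := congr1 (fun w : 'rV_n => w 0 j) vA.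
rewrite !mxE (bigD1 j) //= => eq_j.
have sum_le : `|(b - A j j) * v 0 j| <= t * ((A j j - e) * u j).
  have -> : (b - A j j) * v 0 j = \sum_(i | i != j) v 0 i * A i j.
    by rewrite mulrBl -eq_j; ring.
  apply: le_trans (ler_norm_sum _ _ _) _.
  apply: le_trans (ler_wpM2l (ltW t_gt0) (Au j)); rewrite mulr_sumr.
  apply: ler_sum => i _; rewrite normrM mulrCA mulrC ler_wpM2l //.
  by rewrite -ler_pdivrMr //; exact: jmax.
(* Cancelling [t * u j > 0] leaves [|b - A j j| <= A j j - e], whose lower half is [e <= b]. *)
rewrite normrM vj mulrCA ler_pM2l // ler_pM2r // in sum_le.
by move: sum_le; rewrite ler_norml => /andP[]; lra.
Qed.

(** [ordS] and [ord_pred] are taken modulo [n], so the corner entries need no separate treatment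
    later. *)
Lemma cyclic_neighboursE (n : nat) (i j : 'I_n) :
  cyclic_neighbours i j -> (i == ordS j) || (i == ord_pred j).
Proof.
have [lti ltj] := (ltn_ord i, ltn_ord j).
rewrite /cyclic_neighbours -!val_eqE /=.
case/or4P => [/eqP ij|/eqP ji|/andP[/eqP i0 /eqP jn]|/andP[/eqP iN /eqP j0]].
- by rewrite -ij addSn /= modnDr (modn_small lti) eqxx orbT.
- by rewrite ji (modn_small lti) eqxx.
- by rewrite i0 jn prednK ?modnn //; lia.
- by rewrite j0 add0n (@modn_small n.-1) ?iN ?eqxx ?orbT //; lia.
Qed.

(** Each multiple of [n] removed from the index removes [m] full turns from the angle. *)
Lemma cos_mul_modn (R : realType) (n m k : nat) (phi : R) :
  phi * n%:R = 2 * pi * m%:R ->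
  cos (phi * (k %% n)%:R) = cos (phi * k%:R).
Proof.
move=> phin; rewrite [in RHS](divn_eq k n) natrD natrM.
have -> : phi * ((k %/ n)%:R * n%:R + (k %% n)%:R)
    = phi * (k %% n)%:R + pi *+ 2 *+ (m * (k %/ n)).
  rewrite mulrDr mulrCA phin -[pi *+ 2]mulr_natl -[_ *+ (m * _)]mulr_natl natrM.
  by ring.
by rewrite (periodicn (@cosD2pi R)).
Qed.

(** Concavity: the chord slopes of [sin] on [[0, x]] and [[x, pi / 2]] are [cos c] and [cos d] with
    [c < d]. *)
Lemma jordan_sin (R : realType) (x : R) : 0 < x < pi / 2 -> 2 * x <= pi * sin x.
Proof.
case/andP=> x_gt0 x_lt; have pi0 := pi_gt0 R.
have sin_mvt (a b : R) : a < b ->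
    exists2 c, c \in `]a, b[ & sin b - sin a = cos c * (b - a).
  move=> ab; apply: MVT => //.
  exact/continuous_subspaceT/continuous_sin.
have [c + sin_c] := sin_mvt _ _ x_gt0.
have [d + sin_d] := sin_mvt _ _ x_lt.
rewrite !in_itv /= => /andP[xd d_lt] /andP[c_gt0 cx].
have cos_le : cos d <= cos c.
  by apply/ltW; rewrite ltr_cos ?in_itv /=; lra.
rewrite sin0 !subr0 in sin_c; rewrite sin_pihalf in sin_d.
(* With denominators cleared this reads [x * (1 - sin x) <= (pi / 2 - x) * sin x]. *)
have : cos d * (x * (pi / 2 - x)) <= cos c * (x * (pi / 2 - x)).
  by rewrite ler_wpM2r // mulr_ge0; lra.
nra.
Qed.

Lemma Mxi_eigenvalue_ge (R : realType) (n m : nat) (b : R) :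
  (0 < n)%N -> eigenvalue (Mxi R n m%:Z) b ->
  -1 + (1 - cos (2 * pi * m%:R / n%:R)) / 8 <= b.
Proof.
move=> n_gt0; set phi := 2 * pi * m%:R / n%:R.
have n_neq0 : n%:R != 0 :> R by rewrite pnatr_eq0 -lt0n.
have phin : phi * n%:R = 2 * pi * m%:R by rewrite divfK.
pose u (i : 'I_n) := 1 - cos (phi * i%:R) / 3.
have u_gt0 i : 0 < u i.
  by rewrite /u; have := cos_le1 (phi * i%:R); lra.
apply: (@eigenvalue_ge_of_positive_vector _ _ _ u) => // j.
have uS : u (ordS j) = 1 - cos (phi * j%:R + phi) / 3.
  rewrite /u (cos_mul_modn _ _ _ _ _ phin) -addn1 natrD.
  by congr (1 - cos _ / 3); ring.
have uP : u (ord_pred j) = 1 - cos (phi * j%:R - phi) / 3.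
  rewrite /u (cos_mul_modn _ _ _ _ _ phin).
  (* The added [n] keeps the predecessor of 0 natural and costs [m] full turns. *)
  have -> : phi * (j + n).-1%:R = phi * j%:R - phi + pi *+ 2 *+ m.
    rewrite -subn1 natrB ?addn_gt0 ?n_gt0 ?orbT // natrD.
    rewrite mulrBr mulrDr phin -[pi *+ 2]mulr_natl -[_ *+ m]mulr_natl; ring.
  by rewrite (periodicn (@cosD2pi R)).
have sum_le : \sum_(i | i != j) `|Mxi R n m%:Z i j| * u i
    <= 1 / 4 * u (ordS j) + 1 / 4 * u (ord_pred j).
  have -> : 1 / 4 * u (ordS j) + 1 / 4 * u (ord_pred j) =
      \sum_i ((if i == ordS j then 1 / 4 * u i else 0) +
              (if i == ord_pred j then 1 / 4 * u i else 0)).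
    by rewrite big_split /= -!big_mkcond !big_pred1_eq.
  rewrite big_mkcond; apply: ler_sum => i _; have ui := u_gt0 i.
  case: ifP => [i_neq_j|_]; last by do 2!case: ifP => _; lra.
  rewrite mxE (negbTE i_neq_j).
  case: ifP => [/cyclic_neighboursE|_]; last first.
    by rewrite normr0 mul0r; do 2!case: ifP => _; lra.
  rewrite ger0_norm; last lra.
  by do 2!case: ifP => _; rewrite //= => _; lra.
apply: le_trans sum_le _; rewrite uS uP mxE eqxx /u cosD cosB.
have -> : 2 * pi * (m%:Z)%:~R * j%:R / n%:R = phi * j%:R.
  by rewrite /phi mulrAC.
have := cos_geN1 (phi * j%:R); have := cos_le1 (phi * j%:R).
have := cos_geN1 phi; have := cos_le1 phi.
set y := cos (phi * _); set c := cos phi => c_le1 c_geN1 y_le1 y_geN1.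
(* This product is exactly the right side minus the left. Given the weight 1/3 in [u], the constant
   1/8 is what makes it vanish at the wells [y = -1]; the second factor is at least 1/12. *)
have : 0 <= (1 + y) * (1 / 2 - y / 6 - (1 - c) / 8).
  by rewrite mulr_ge0; lra.
by lra.
Qed.

Theorem proposition6 (R : realType) :
  exists eps : nat -> R,
    eps n @[n --> \oo] --> (0 : R) /\
    forall (n : nat) (xi : int),
      odd n -> (3 <= n)%N ->
      n%:R / ln (n%:R : R) <= xi%:~R -> (xi%:~R : R) < n%:R / 2 ->
      forall beta : R, is_smallest_eigenvalue (Mxi R n xi) beta ->
        beta >= -1 + 3 / 4 * (xi%:~R / n%:R) ^+ 2 * (1 + eps n).
Proof.
exists (fun=> 0); split; first exact: cvg_cst.
move=> n xi _ n_ge3 xi_ge xi_lt beta [beta_eig _].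
have n_gt0 : (0 : R) < n%:R by rewrite ltr0n; lia.
have xi_gt0 : 0 < (xi%:~R : R).
  by apply: lt_le_trans xi_ge; rewrite divr_gt0 // ln_gt0 // ltr1n; lia.
case: xi xi_gt0 xi_lt {xi_ge} beta_eig => [m|m]; last first.
  by rewrite ltr0z.
rewrite -pmulrn => m_gt0 m_lt /Mxi_eigenvalue_ge; move/(_ ltac:(lia)).
apply: le_trans.
set a := m%:R / n%:R.
have a_gt0 : 0 < a by rewrite divr_gt0.
have a_lt : a < 1 / 2 by rewrite /a ltr_pdivrMr //; lra.
have pi0 := pi_gt0 R.
(* [xi < n / 2] places [pi * a] in Jordan's range. *)
have sin_ge : 2 * a <= sin (pi * a).
  rewrite -(ler_pM2l pi0) mulrCA; apply: jordan_sin.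
  by rewrite mulr_gt0 //= ltr_pM2l //; lra.
have -> : cos (2 * pi * m%:R / n%:R) = 1 - 2 * sin (pi * a) ^+ 2.
  have -> : 2 * pi * m%:R / n%:R = (pi * a) *+ 2.
    by rewrite -mulr_natl /a; ring.
  by rewrite cos_mulr2n cos2sin2 -[_ *+ 2]mulr_natl; ring.
(* The gain is [sin (pi * a) ^+ 2 / 4 >= a ^+ 2], above the required [3 / 4 * a ^+ 2]. *)
by nra.
Qed.
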